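(* Let $\langle X,\Theta,P\rangle$ be a (dominated) statistical model, let $\alpha\in(0,1)$, and let $\tau=(\tau_\pi)_{\pi\in\mathcal M(\Theta)}$ be a family of $1-\alpha$ credible regions with rejection probability function $\varphi(\theta,x;\pi)$. Suppose that $\Theta$ is compact and that, for every $\theta\in\Theta$, the function $(x,\pi)\mapsto\varphi(\theta,x;\pi)$ from $X\times\mathcal M(\Theta)$ to $[0,1]$ is jointly continuous, where $\mathcal M(\Theta)$ is equipped with the Wasserstein metric $W_1$. Then there exists a matching prior for $\tau$ (at level $1-\alpha$), that is, there is $\pi_0\in\mathcal M(\Theta)$ such that $\tau_{\pi_0}$ is both a $1-\alpha$ credible region with respect to $\pi_0$ and a $1-\alpha$ confidence set.
   Context: **Models.** $(X,d_X)$ and $(\Theta,d_\Theta)$ are metric spaces with Borel $\sigma$-algebras $\mathcal B_X,\mathcal B_\Theta$; $\mathcal M(X)$, $\mathcal M(\Theta)$ are the sets of Borel probability measures on them. A statistical model $\langle X,\Theta,P\rangle$ consists of these together with a probability kernel (measurable map) $P:\Theta\to\mathcal M(X)$, $\theta\mapsto P_\theta$. Models are assumed dominated: there are a $\sigma$-finite measure $\nu$ on $X$ and a product measurable $q:\Theta\times X\to[0,\infty)$ such that $q(\theta,\cdot)$ is a density of $P_\theta$ with respect to $\nu$ for every $\theta$. For $\pi\in\mathcal M(\Theta)$ (a prior), the marginal is $(\pi P)(A)=\int_\Theta P_\theta(A)\,\pi(d\theta)$, and $P^x_\pi$ denotes a fixed version (for all $\pi$ and $x$) of the posterior distribution, measurable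 in $x$ and satisfying $P^x_\pi(B)=\int_B q(\theta,x)\pi(d\theta)/\int_\Theta q(\theta,x)\pi(d\theta)$ for $\pi P$-almost all $x$ and all $B\in\mathcal B_\Theta$. **Set estimators.** A randomized set estimator is a map $\tau:X\times[0,1]\to\mathcal B_\Theta$ such that $(\theta,x,u)\mapsto\mathbf 1[\theta\in\tau(x,u)]$ is product measurable. Its acceptance probability function is $\psi(\theta,x)=\int_0^1\mathbf 1[\theta\in\tau(x,u)]\,du$ and its rejection probability function is $\varphi=1-\psi$. It is a $1-\alpha$ credible region with respect to $\pi$ if $\int_\Theta\psi(\theta,x)\,P^x_\pi(d\theta)=1-\alpha$ for $\pi P$-almost all $x$. It is a $1-\alpha$ confidence set if $\int_X\varphi(\theta,x)\,P_\theta(dx)\le\alpha$ for all $\theta\in\Theta$. A family $\tau=(\tau_\pi)_{\pi\in F}$ of $1-\alpha$ credible regions ($F\subseteq\mathcal M(\Theta)$) is one in which each $\tau_\pi$ is a $1-\alpha$ credible region with respect to $\pi$; its rejection probability function is $\varphi(\theta,x;\pi)=1-\int_0^1\mathbf 1[\theta\in\tau_\pi(x,u)]\,du$. **Wasserstein metric.** $W_1(\mu,\nu)$ is the infimum of $\int d_\Theta(x,y)\,\kappa(dx,dy)$ over couplings $\kappa$ of $\mu$ and $\nu$. *)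

(* Defs.v *)
(* MathComp-Analysis; all spaces are over an abstract [R : realType]. *)
From HB Require Import structures.
From mathcomp Require Import all_boot all_order all_algebra.
From mathcomp Require Import all_classical all_reals all_analysis.

Set Implicit Arguments.
Unset Strict Implicit.
Unset Printing Implicit Defensive.

Import Order.TTheory GRing.Theory Num.Theory.
Import numFieldNormedType.Exports.

Local Open Scope classical_set_scope.
Local Open Scope ring_scope.

(* Metric spaces carrying their Borel sigma-algebra.  A [measurableType] is
   pointed, so these spaces are nonempty; for the parameter space of a model
   this is needed for a prior to exist, and a sample space carrying a
   probability measure is never empty. *)
HB.mixin Record isBorel (d : measure_display) T
    of Measurable d T & Topological T := {
  borel_measurableE : @measurable d T = <<s @open T >>
}.

#[short(type="borelMetricType")]
HB.structure Definition BorelMetric (d : measure_display) (R : realType) :=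
  { T of Measurable d T & Metric R T & isBorel d T }.

Section models.
Context (R : realType) (dX dT : measure_display).
Context (X : borelMetricType dX R) (Theta : borelMetricType dT R).

Definition is_density (P : R.-pker Theta ~> X)
    (nu : {sigma_finite_measure set X -> \bar R}) (q : Theta * X -> R) : Prop :=
  [/\ measurable_fun setT q,
      forall z, 0 <= q z &
      forall theta A, measurable A ->
        P theta A = (\int[nu]_(x in A) (q (theta, x))%:E)%E].

Section marginal.
Variables (P : R.-pker Theta ~> X) (pi : probability Theta R).
Local Open Scope ereal_scope.

Definition marginal (A : set X) : \bar R := \int[pi]_theta P theta A.

Let marginal0 : marginal set0 = 0.
Proof. by rewrite /marginal; apply: integral0_eq => t _; rewrite measure0. Qed.

Let marginal_ge0 A : 0 <= marginal A.
Proof. exact: integral_ge0. Qed.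

Let marginal_sigma_additive : semi_sigma_additive marginal.
Proof.
move=> F mF tF mUF; rewrite [X in _ --> X](_ : _ =
    \int[pi]_t (\sum_(0 <= n <oo) P t (F n))); last first.
  apply: eq_integral => t _.
  by apply/esym/cvg_lim => //; exact/measure_semi_sigma_additive.
apply/cvg_closeP; split.
  by apply: is_cvg_nneseries => n _; rewrite integral_ge0.
rewrite closeE// integral_nneseries// => n; exact: measurable_kernel.
Qed.

HB.instance Definition _ := isMeasure.Build _ _ _ marginal
  marginal0 marginal_ge0 marginal_sigma_additive.

Let marginal_setT : marginal setT = 1.
Proof.
rewrite /marginal (eq_integral (cst 1)); last by move=> t _; rewrite prob_kernel.
by rewrite integral_cst// mul1e; exact: probability_setT.
Qed.

HB.instance Definition _ :=
  Measure_isProbability.Build _ _ _ marginal marginal_setT.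

End marginal.

(* [post] is a version of the posterior of the prior [pi].  The quotient is that
   of extended reals; its denominator lies in ]0, +oo[ for almost all [x] with
   respect to the marginal. *)
Definition is_posterior (P : R.-pker Theta ~> X) (q : Theta * X -> R)
    (pi : probability Theta R) (post : R.-pker X ~> Theta) : Prop :=
  {ae marginal P pi, forall x, forall B : set Theta, measurable B ->
     post x B = ((\int[pi]_(theta in B) (q (theta, x))%:E)
                 / (\int[pi]_theta (q (theta, x))%:E))%E}.

(* The randomizing variable [u] ranges over [0, 1]: the values of [tau x] outside
   that interval are irrelevant to all the definitions below. *)
Definition is_randomized_set_estimator (tau : X -> R -> set Theta) : Prop :=
  (forall x u, u \in `[0, 1] -> measurable (tau x u)) /\
  measurable_fun [set z : Theta * X * R | z.2 \in `[0, 1]]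
    (fun z : Theta * X * R => \1_(tau z.1.2 z.2) z.1.1 : R).

Definition acceptance (tau : X -> R -> set Theta) (theta : Theta) (x : X) : R :=
  \int[@lebesgue_measure R]_(u in `[0, 1]) \1_(tau x u) theta.

Definition rejection (tau : X -> R -> set Theta) (theta : Theta) (x : X) : R :=
  1 - acceptance tau theta x.

(* [alpha] stands for the level 1 - alpha. *)
Definition is_credible_region (P : R.-pker Theta ~> X)
    (pi : probability Theta R) (post : R.-pker X ~> Theta) (alpha : R)
    (tau : X -> R -> set Theta) : Prop :=
  is_randomized_set_estimator tau /\
  {ae marginal P pi, forall x,
     (\int[post x]_theta (acceptance tau theta x)%:E)%E = (1 - alpha)%:E}.

Definition is_confidence_set (P : R.-pker Theta ~> X) (alpha : R)
    (tau : X -> R -> set Theta) : Prop :=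
  is_randomized_set_estimator tau /\
  forall theta, (\int[P theta]_x (rejection tau theta x)%:E <= alpha%:E)%E.

End models.

Section wasserstein.
Context (R : realType) (d : measure_display) (T : borelMetricType d R).

Definition coupling (mu nu : probability T R) : set (probability (T * T)%type R) :=
  [set kappa | forall A : set T, measurable A ->
     kappa (A `*` setT) = mu A /\ kappa (setT `*` A) = nu A].

(* Couplings live on the product sigma-algebra, for which the distance is
   measurable as soon as [T] is separable, in particular compact. *)
Definition W1 (mu nu : probability T R) : \bar R :=
  ereal_inf [set (\int[kappa]_z (mdist z.1 z.2)%:E)%E | kappa in coupling mu nu].

(* The neighbourhood filter of [mu] generated by the open W1-balls. *)
Definition W1_nbhs (mu : probability T R) : set_system (probability T R) :=
  filter_from [set e : R | 0 < e] (fun e => [set nu | (W1 mu nu < e%:E)%E]).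

End wasserstein.

(* Continuity on X * M(Theta) with the metric of X and W1 on M(Theta). *)
Definition jointly_continuous (R : realType) (dX dT : measure_display)
    (X : borelMetricType dX R) (Theta : borelMetricType dT R)
    (f : X -> probability Theta R -> R) : Prop :=
  forall (x : X) (pi : probability Theta R),
    (fun z : X * probability Theta R => f z.1 z.2)
      @ filter_prod (nbhs x) (W1_nbhs pi) --> f x pi.

(* Main.v *)
(* For a prior pi write r(theta, pi) for the rejection probability of tau_pi at
   theta under P_theta.  The credibility of tau_pi gives
   \int r(theta, pi) pi(dtheta) = alpha, and r(theta, .) is continuous in W1 for
   each theta, so the sets {pi | r(theta, pi) <= alpha} are closed and one needs
   a common point.  For finitely many theta_i, restrict to the priors
   sum_i p_i delta_(theta_i): Scarf's form of the KKM lemma yields p such that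
   p_i > 0 only where r(theta_i, pi_p) is maximal, and averaging against p shows
   that this maximum is alpha.

   Compactness comes from a parametrization of priors rather than from
   Prokhorov's theorem: Theta is a continuous image of the Cantor space, and
   arbitrary thresholds t : seq bool -> [0, 1] turn a uniform variable u into a
   point of the Cantor space (the next bit after the prefix w is [t w <= u]).
   The space of thresholds is compact by Tychonoff's theorem, the law of the
   resulting point of Theta is W1-continuous in t because all these variables
   live on the same probability space, and every finitely supported prior
   arises this way. *)
From HB Require Import structures.
From mathcomp Require Import all_boot.

Set Implicit Arguments.
Unset Strict Implicit.
Unset Printing Implicit Defensive.

(** * Scarf's lemma *)

Section Scarf_pivot.
Variables (E I : finType) (rk : I -> E -> nat).
Hypothesis rk_inj : forall i, injective (rk i).

(** Applied to [y] in [Z], the condition makes [y] the minimum of [Z] in some order, so the map from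
    orders to minima is onto [Z]. *)
Definition dominant (Z : {set E}) :=
  [forall y, exists i, [forall x in Z, rk i y <= rk i x]].

Lemma dominantP (Z : {set E}) :
  reflect (forall y, exists i, forall x, x \in Z -> rk i y <= rk i x) (dominant Z).
Proof.
apply: (iffP forallP) => H y.
  by have /existsP[i /forall_inP Hi] := H y; exists i.
by have [i Hi] := H y; apply/existsP; exists i; apply/forall_inP.
Qed.

(* In Scarf's terminology a dominant set of size [#|I| - 1] is a door, one of
   size [#|I|] a room; [rooms Z] indexes the rooms having the door [Z]. *)
Definition rooms (Z : {set E}) := [set y | y \notin Z & dominant (y |: Z)].

Definition above (Z : {set E}) (j : I) :=
  [set y | [forall (i | i != j), [exists x in Z, rk i x < rk i y]]].

(* Exactly two of the orders, [a] and [b] below, have the same minimum on [Z];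
   the two rooms are obtained by adding the [a]-greatest element of [above Z a]
   or the [b]-greatest element of [above Z b]. *)
Lemma card_rooms (Z : {set E}) : dominant Z -> #|Z|.+1 = #|I| -> Z != set0 ->
  (forall j, above Z j != set0) ->
  #|rooms Z| = 2.
Proof.
move=> /dominantP domZ cZ /set0Pn[z0 z0Z] aboveN0.
pose mu i := [arg min_(x < z0 in Z) rk i x].
have muZ i : mu i \in Z by rewrite /mu; case: arg_minnP.
have mu_min i x : x \in Z -> rk i (mu i) <= rk i x.
  by rewrite /mu; case: arg_minnP => // z zZ H /H.
have mu_uniq i x : (forall z, z \in Z -> rk i x <= rk i z) -> x \in Z -> mu i = x.
  by move=> H xZ; apply: (rk_inj (i := i)); apply/eqP; rewrite eqn_leq mu_min// H.
have mu_surj x : x \in Z -> exists i, mu i = x.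
  by move=> xZ; have [i /mu_uniq Hi] := domZ x; exists i; apply: Hi.
have aboveP j y : reflect (forall i, i != j -> rk i (mu i) < rk i y) (y \in above Z j).
  rewrite inE; apply: (iffP forall_inP) => H i ij.
    by have /exists_inP[x xZ] := H i ij; apply: leq_ltn_trans (mu_min _ _ xZ).
  by apply/exists_inP; exists (mu i) => //; exact: H.
have [a [b [ab muab]]] : exists a b, a != b /\ mu a = mu b.
  case: (boolP (injectiveb mu)) => [/injectiveP inj|].
    have := max_card (mem Z); have := card_imset predT inj.
    have /subset_leq_card : mu @: predT \subset Z.
      by apply/subsetP => _ /imsetP[i _ ->].
    by move=> + H; rewrite H -cZ ltnn.
  by case/injectivePn => a [b] ab eqm; exists a, b.
(* Since [Z] has one element fewer than [I], a nonempty [S] whose complement still attains every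
   minimum is a singleton, and [mu] is injective on the complement. As [mu a = mu b], the singleton
   is [a] or [b]. *)
have pivotP (S : {set I}) : Z \subset mu @: (~: S) -> S != set0 ->
    S = [set a] \/ S = [set b].
  move=> ZS S0; have cS : #|~: S| + #|S| = #|Z|.+1 by rewrite cZ addnC cardsC.
  have S0' : 0 < #|S| by rewrite card_gt0.
  have le1 := subset_leq_card ZS; have le2 := leq_imset_card mu (~: S).
  have S1 : #|S| = 1.
    apply/eqP; rewrite eqn_leq S0' andbT -(leq_add2l #|~: S|) cS addn1 ltnS.
    exact: leq_trans le2.
  have : ~~ ((a \in ~: S) && (b \in ~: S)).
    apply/negP => /andP[aS bS].
    have inj : {in (~: S) &, injective mu}.
      apply/imset_injP; rewrite eqn_leq le2/=; apply: leq_trans le1.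
      by move: cS; rewrite S1 addn1 => -[->].
    by move/eqP: ab; apply; apply: inj.
  have /cards1P[s ->] : #|S| == 1 by rewrite S1.
  by rewrite !inE -negb_or negbK => /orP[]/eqP ->; [left|right].
have ab_surj j x : (j == a) || (j == b) -> x \in Z -> exists2 i, i != j & mu i = x.
  move=> jab /mu_surj[i <-].
  case: (eqVneq i j) => [->|]; last by exists i.
  by case/orP: jab => /eqP ->; [exists b => //; rewrite eq_sym|exists a].
have above_notin j y : (j == a) || (j == b) -> y \in above Z j -> y \notin Z.
  move=> jab /aboveP yj; apply/negP => /(ab_surj j _ jab)[i ij mui].
  by have := yj i ij; rewrite mui ltnn.
have above_lt j y : (j == a) || (j == b) -> y \in above Z j -> rk j y <= rk j (mu j).
  move=> jab /aboveP yj; have [i yi] := domZ y.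
  case: (eqVneq i j) => [<-|/yj]; first exact: yi.
  by rewrite ltnNge yi.
have above_room j y : (j == a) || (j == b) -> y \in above Z j ->
    (forall z, z \in above Z j -> rk j z <= rk j y) -> y \in rooms Z.
  move=> jab yj ymax; rewrite inE (above_notin j)//=; apply/dominantP => z.
  case: (boolP (z \in above Z j)) => [zj|].
    exists j => x /setU1P[->|xZ]; first exact: ymax.
    apply: leq_trans (ymax _ zj) _; apply: leq_trans (mu_min _ _ xZ).
    exact: above_lt.
  rewrite inE => /forall_inPn[i ij]; rewrite negb_exists_in => /forall_inP H.
  have zle x : x \in Z -> rk i z <= rk i x by move/H; rewrite -leqNgt.
  exists i => x /setU1P[->|]; last exact: zle.
  by apply: leq_trans (zle _ (muZ i)) _; apply: ltnW; move/aboveP: yj; apply.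
have room_above y : y \in rooms Z -> exists j, [/\ (j == a) || (j == b),
    y \in above Z j & forall z, z \in above Z j -> rk j z <= rk j y].
  rewrite inE => /andP[yZ /dominantP domy].
  (* The orders in which [y] takes over as minimum once it is added to [Z]; dominance of the room
     leaves exactly one. *)
  pose S := [set i | rk i y < rk i (mu i)].
  have ZS : Z \subset mu @: (~: S).
    apply/subsetP => x xZ; have [i Hi] := domy x.
    apply/imsetP; exists i; last first.
      by rewrite (mu_uniq i x)// => z zZ; apply: Hi; rewrite setU1r.
    by rewrite !inE -leqNgt (mu_uniq i x) ?Hi ?setU11// => z zZ; rewrite Hi ?setU1r.
  have S0 : S != set0.
    have [j Hj] := domy y; apply/set0Pn; exists j; rewrite inE ltn_neqAle.
    rewrite Hj ?setU1r// andbT; apply/eqP => /rk_inj E'.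
    by move: yZ; rewrite E' muZ.
  suff S1 j : S = [set j] -> y \in above Z j /\
      (forall z, z \in above Z j -> rk j z <= rk j y).
    by case: (pivotP S ZS S0) => Sj; [exists a|exists b];
       have [] := S1 _ Sj; rewrite eqxx ?orbT.
  move=> Sj; split.
    apply/aboveP => i ij.
    have : i \notin S by rewrite Sj inE.
    rewrite inE -leqNgt leq_eqVlt => /orP[/eqP/rk_inj E'|//].
    by move: yZ; rewrite -E' muZ.
  move=> z /aboveP zj; have [i Hi] := domy z.
  case: (eqVneq i j) => [<-|/zj]; first by rewrite Hi ?setU11.
  by rewrite ltnNge Hi// setU1r.
have topP j : exists2 y, y \in above Z j &
    forall z, z \in above Z j -> rk j z <= rk j y.
  have /set0Pn[y yj] := aboveN0 j.
  by case: (@arg_maxnP _ y (mem (above Z j)) (rk j)) => // t; exists t.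
have [ya yaA ya_max] := topP a.
have [yb ybB yb_max] := topP b.
suff -> : rooms Z = [set ya; yb].
  rewrite cards2; suff -> : ya != yb by [].
  (* A common element would exceed the minimum of [Z] in every order: in those other than [a] as
     [ya], in [a] as [yb]. *)
  apply/eqP => E'; have [i Hi] := domZ ya.
  have := Hi _ (muZ i); rewrite leqNgt; case: (eqVneq i a) => [->|ia].
    by rewrite E' (aboveP b yb ybB a ab).
  by rewrite (aboveP a ya yaA i ia).
apply/setP => y; rewrite !inE; apply/idP/idP.
  move=> yR; have [|j [jab yj ymax]] := room_above y; first by rewrite inE.
  case/orP: jab yj ymax => /eqP -> yj ymax; apply/orP; [left|right];
    by apply/eqP/rk_inj/eqP; rewrite eqn_leq; apply/andP; split;
       [apply: ya_max || apply: yb_max|apply: ymax].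
case/orP => /eqP ->.
  by have : ya \in rooms Z by [apply: (above_room a); rewrite ?eqxx]; rewrite inE.
by have : yb \in rooms Z by [apply: (above_room b); rewrite ?eqxx ?orbT]; rewrite inE.
Qed.

End Scarf_pivot.

(** If removing [y] leaves exactly the colours other than [i0], then [f] is injective on the rest
    and [f y], not being [i0], is repeated at a single [y']. Then [y] and [y'] are the only
    removable elements; otherwise there are none. *)
Lemma even_card_doors (E I : finType) (f : E -> I) (i0 : I) (Z : {set E}) :
  #|Z| = #|I| -> f @: Z != [set: I] ->
  ~~ odd #|[set y in Z | f @: (Z :\ y) == [set~ i0]]|.
Proof.
move=> cZ fZ; set S := [set y in Z | _].
have [->|/set0Pn[y]] := eqVneq S set0; first by rewrite cards0.
rewrite inE => /andP[yZ /eqP fy].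
have inj : {in Z :\ y &, injective f}.
  apply/imset_injP; rewrite fy cardsC1 -cZ (cardsD1 y Z) yZ.
  by rewrite addnC addn1.
have fyi0 : f y \in [set~ i0].
  rewrite !inE; apply/eqP => fyE; move/eqP: fZ; apply.
  by rewrite -(setD1K yZ) imsetU1 fy fyE setUCr.
have /imsetP[y' y'Z fyy'] : f y \in f @: (Z :\ y) by rewrite fy.
move: (y'Z); rewrite !inE => /andP[y'y y'Z0].
suff -> : S = [set y; y'] by rewrite cards2 eq_sym y'y.
apply/setP => x; rewrite !inE; apply/idP/idP; last first.
  case/orP => /eqP ->; first by rewrite yZ fy eqxx.
  rewrite y'Z0 /= -fy; apply/eqP/setP => i.
  apply/imsetP/imsetP => -[w]; rewrite !inE => /andP[wy wZ] ->.
    case: (eqVneq w y) => [->|wy']; first by exists y'.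
    by exists w => //; rewrite !inE wy'.
  case: (eqVneq w y') => [->|wy']; last by exists w => //; rewrite !inE wy'.
  by exists y => //; rewrite !inE eq_sym y'y.
move=> /andP[xZ /eqP fx]; rewrite -[_ || _]negbK negb_or; apply/negP => /andP[xy xy'].
have xZy : x \in Z :\ y by rewrite !inE xy.
have : f x \in [set~ i0] by rewrite -fy imset_f.
rewrite -fx => /imsetP[w]; rewrite !inE => /andP[wx wZ] fxw.
case: (eqVneq w y) => wy.
  by move/eqP: xy'; apply; apply: inj => //; rewrite fxw wy.
by move/eqP: wx; apply; apply: inj => //; rewrite !inE wy.
Qed.

Lemma card_pairs (A B : finType) (S : {set A * B}) :
  #|S| = \sum_a #|[set b | (a, b) \in S]|.
Proof.
rewrite -sum1_card; under [RHS]eq_bigr do rewrite -sum1_card.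
by rewrite pair_big_dep /=; apply: eq_bigl => -[a b] /=; rewrite inE.
Qed.

Lemma even_sum (A : finType) (P : pred A) (F : A -> nat) :
  (forall a, P a -> ~~ odd (F a)) -> ~~ odd (\sum_(a | P a) F a).
Proof.
move=> H; elim/big_ind: _ => // m n; rewrite oddD.
by move=> /negbTE -> /negbTE ->.
Qed.

(** * Slack vectors and the parity argument *)

Section Scarf.
Variables (T I : finType) (x0 : T) (i0 : I) (rk : I -> T -> nat) (c : T -> I).
Hypothesis rk_inj : forall i, injective (rk i).

(** One successor matches the shift of the ranks of [T], which frees 0 for the least slack vector;
    the other makes the bound strict. *)
Let B := (\max_i \max_x rk i x).+2.

(* The elements [inr j] are Scarf's slack vectors: [inr i] is the least element
   of the [i]-th order, in which every other slack vector lies above [T]. *)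
Let rks (i : I) (z : T + I) : nat :=
  match z with
  | inl x => (rk i x).+1
  | inr j => if j == i then 0 else B + enum_rank j
  end.

Let cs (z : T + I) : I := match z with inl x => c x | inr j => j end.

Let rksB i x : rks i (inl x) < B.
Proof.
rewrite /rks /B !ltnS.
by apply: leq_trans (leq_bigmax i); exact: (leq_bigmax x).
Qed.

Let rks_inj i : injective (rks i).
Proof.
have H x j : rks i (inl x) <> rks i (inr j).
  have := rksB i x; rewrite /rks; case: ifP => // _ + E.
  by rewrite E ltnNge leq_addr.
move=> [x|j] [y|k] //; first by move=> /= [] /rk_inj ->.
- by move/H.
- by move/esym/H.
rewrite /rks; case: (eqVneq j i) => [->|_]; case: (eqVneq k i) => [->|_] //.
by move=> /addnI/ord_inj/enum_rank_inj ->.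
Qed.

Let Z0 : {set T + I} := inr @: [set~ i0].

Let typed (Z : {set T + I}) :=
  [&& dominant rks Z, #|Z|.+1 == #|I| & cs @: Z == [set~ i0]].

Let typed_Z0 : typed Z0.
Proof.
apply/and3P; split.
- apply/dominantP => -[y|j].
    exists i0 => _ /imsetP[k + ->]; rewrite !inE => ki0.
    by apply: ltnW; apply: leq_trans (rksB i0 y) _; rewrite /rks (negbTE ki0) leq_addr.
  by exists j => x _; rewrite /rks eqxx.
- rewrite card_imset; last by move=> ? ? [].
  by rewrite cardsC1 prednK//; apply/card_gt0P; exists i0.
- rewrite -imset_comp; apply/eqP/setP => i; apply/imsetP/idP => [[j jP ->]//|iP].
  by exists i.
Qed.

(** In an order [i != i0] the door already contains the least element [inr i], so only the order
    [i0] can witness dominance at elements of [T]. This forces the added element to be the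
    [i0]-greatest one of [T]. *)
Let card_rooms_Z0 : #|rooms rks Z0| = 1.
Proof.
pose m := [arg max_(x > x0) rk i0 x].
have mP x : rk i0 x <= rk i0 m by rewrite /m; case: arg_maxnP => // t _; apply.
suff -> : rooms rks Z0 = [set inl m] by rewrite cards1.
apply/setP => z; rewrite !inE; apply/andP/eqP.
  case: z => [x|j] [zZ0 /dominantP domz].
    congr inl; apply: (rk_inj (i := i0)); apply/eqP; rewrite eqn_leq mP.
    have [i Hi] := domz (inl m).
    have := Hi (inl x) (setU11 _ _); rewrite /= ltnS.
    case: (eqVneq i i0) => [-> //|ii0] _.
    have := Hi (inr i); rewrite setU1r /rks ?eqxx; last first.
      by apply: imset_f; rewrite !inE.
    by move=> /(_ isT).
  have ji0 : j = i0.
    by apply/eqP; apply: contraR zZ0 => ji0; apply: imset_f; rewrite !inE.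
  have [i Hi] := domz (inl x0); have := Hi (inr i).
  rewrite {2}/rks eqxx; suff -> : inr i \in inr j |: Z0 by move=> /(_ isT).
  rewrite !inE ji0; case: (eqVneq i i0) => [->|ii0]; first by rewrite eqxx.
  by apply/orP; right; apply: imset_f; rewrite !inE.
move=> ->; split; first by apply/imsetP => -[].
apply/dominantP => -[y|j]; last by exists j => x _; rewrite /rks eqxx.
exists i0 => w /setU1P[->|]; first by rewrite /rks ltnS.
move=> /imsetP[k + ->]; rewrite !inE => ki0.
by apply: ltnW; apply: leq_trans (rksB i0 y) _; rewrite /rks (negbTE ki0) leq_addr.
Qed.

(** Such a door contains some [inl x], and each [inr j] lies above [inl x] in every order but [j];
    hence the sets [above Z j] are nonempty and [card_rooms] applies. *)
Let card_rooms_typed Z : typed Z -> Z != Z0 -> #|rooms rks Z| = 2.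
Proof.
move=> /and3P[domZ /eqP cZ /eqP csZ] ZZ0.
have [x xZ] : exists x, inl x \in Z.
  apply/existsP; apply: contraR ZZ0 => /existsPn H.
  rewrite /Z0 -csZ -imset_comp; apply/eqP/setP => -[x|j].
    by rewrite (negbTE (H x)); apply/esym/imsetP => -[[y|k]].
  apply/idP/imsetP => [jZ|[[y|k]] yZ]; first by exists (inr j).
    by move: (H y); rewrite yZ.
  by case=> ->.
apply: card_rooms => //.
  by apply/set0Pn; exists (inl x).
move=> j; apply/set0Pn; exists (inr j); rewrite inE; apply/forall_inP => i ij.
apply/exists_inP; exists (inl x) => //.
by apply: leq_trans (rksB i x) _; rewrite /rks eq_sym (negbTE ij) leq_addr.
Qed.

(* Count the pairs (door coloured by [~: i0], room having it).  Every such door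
   but [Z0] lies in two rooms, [Z0] in one, so the count is odd; a room whose
   colours are not all of [I] contributes an even number. *)
Lemma Scarf : exists (C : {set I}) (s : {set T}),
  (forall i, i \in C -> exists2 x, x \in s & c x = i) /\
  (forall y, exists2 i, i \in C & forall x, x \in s -> rk i y <= rk i x).
Proof.
suff [Z /dominantP domZ csZ] : exists2 Z, dominant rks Z & cs @: Z = [set: I].
  (* If [inr i] is absent, colour [i] can only come from [T]. If it is present, order [i] has
     minimum 0 on [Z] and cannot bound the positive rank of [inl y]. *)
  exists [set i | inr i \notin Z], [set x | inl x \in Z]; split.
    move=> i; rewrite inE => iZ.
    have : i \in cs @: Z by rewrite csZ inE.
    case/imsetP => -[x|j] xZ /= ix; first by exists x; rewrite ?inE.
    by rewrite ix xZ in iZ.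
  move=> y; have [i Hi] := domZ (inl y); exists i => [|x].
    by rewrite inE; apply/negP => /Hi; rewrite /rks eqxx.
  by rewrite inE => /Hi; rewrite /rks ltnS.
have [|/exists_inPn H] := boolP [exists (Z | dominant rks Z), cs @: Z == [set: I]].
  by case/exists_inP => Z domZ /eqP csZ; exists Z.
pose S := [set p : {set T + I} * (T + I) | typed p.1 & p.2 \in rooms rks p.1].
pose S' := [set p : {set T + I} * (T + I) | [&& dominant rks p.1, #|p.1| == #|I|,
  p.2 \in p.1 & cs @: (p.1 :\ p.2) == [set~ i0]]].
(* Passes from a door with the element to add to the room with the element to remove. *)
pose h (p : {set T + I} * (T + I)) := (p.2 |: p.1, p.2).
have hinj : {in S &, injective h}.
  move=> [Z y] [Z' y']; rewrite !inE /= => /and3P[_ yZ _] /and3P[_ yZ' _].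
  rewrite /h /= => -[E E']; rewrite E' in yZ E *.
  by rewrite -(setU1K yZ) E setU1K.
have SS' : S' = h @: S.
  apply/setP => -[Z y]; apply/idP/imsetP.
    rewrite inE /= => /and4P[/dominantP domZ /eqP cZ yZ csZ].
    exists (Z :\ y, y); last by rewrite /h /= setD1K.
    rewrite !inE /= /typed eqxx /= setD1K// csZ -cZ [in X in _ == X](cardsD1 y) yZ eqxx.
    rewrite andbT /= andbC; apply/andP; split; first by apply/dominantP.
    rewrite andbT; apply/dominantP => z; have [i Hi] := domZ z; exists i => x.
    by rewrite !inE => /andP[_ /Hi].
  move=> [[Z' y']]; rewrite !inE /= => /and3P[/and3P[_ /eqP cZ' csZ'] y'Z' domy'].
  rewrite /h /= => -[-> ->]; rewrite domy' cardsU1 y'Z' add1n cZ' eqxx /= setU11.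
  by rewrite setU1K.
have : odd #|S|.
  rewrite card_pairs (bigD1 Z0)//= oddD.
  rewrite (_ : [set b | _] = rooms rks Z0); last first.
    by apply/setP => b; rewrite !inE /= typed_Z0.
  rewrite card_rooms_Z0 /= -[~~ _]/(~~ _); apply: even_sum => Z ZZ0.
  have [tZ|ntZ] := boolP (typed Z).
    rewrite (_ : [set b | _] = rooms rks Z); last by apply/setP => b; rewrite !inE /= tZ.
    by rewrite card_rooms_typed.
  rewrite (_ : [set b | _] = set0) ?cards0//.
  by apply/setP => b; rewrite !inE /= (negbTE ntZ).
rewrite -(card_in_imset hinj) -SS' card_pairs => oddS; exfalso; move: oddS; apply/negP.
apply: even_sum => Z _.
have [/andP[domZ /eqP cZ]|ndomZ] := boolP (dominant rks Z && (#|Z| == #|I|)).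
  rewrite (_ : [set b | _] = [set y in Z | cs @: (Z :\ y) == [set~ i0]]).
    by apply: even_card_doors => //; apply: H.
  by apply/setP => b; rewrite !inE /= domZ cZ eqxx.
rewrite (_ : [set b | _] = set0) ?cards0//; apply/setP => b; rewrite !inE /=.
by rewrite andbA (negbTE ndomZ).
Qed.

End Scarf.

(** * Lattice points of the simplex *)

Lemma bounded_fun_sum (n N : nat) (F : 'I_n -> nat) : \sum_i F i = N ->
  exists x : {ffun 'I_n -> 'I_N.+1}, forall i, x i = F i :> nat.
Proof.
move=> sF; exists [ffun i => inord (F i)] => i; rewrite ffunE inordK//.
by rewrite ltnS -sF (bigD1 i)//= leq_addr.
Qed.

(* Lattice points of the simplex [\sum_i x i = N], ordered by their [i]-th
   coordinates with ties broken arbitrarily.  Dominance forces the minima [m i]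
   to satisfy [N < \sum_(i in C) (m i + 1)], hence a dominant set has diameter
   at most the number of coordinates. *)
Lemma Scarf_lattice (n N : nat) (c : {ffun 'I_n.+1 -> 'I_N.+1} -> 'I_n.+1) :
  exists (C : {set 'I_n.+1}) (x : {ffun 'I_n.+1 -> 'I_N.+1}),
  [/\ \sum_i x i = N,
      forall i, i \notin C -> x i <= n.+1 &
      forall i, i \in C -> exists y : {ffun 'I_n.+1 -> 'I_N.+1},
        [/\ \sum_i y i = N, c y = i &
            forall j, (y j <= x j + n.+1) && (x j <= y j + n.+1)]].
Proof.
pose T : finType := {x : {ffun 'I_n.+1 -> 'I_N.+1} | \sum_i x i == N}.
have mkT F : \sum_i F i = N -> exists x : T, forall i, val x i = F i :> nat.
  move=> sF; have [x xF] := bounded_fun_sum sF.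
  have xP : \sum_i x i == N by rewrite (eq_bigr _ (fun i _ => xF i)) sF.
  by exists (Sub x xP).
have [x0 _] : exists x : T, forall i, val x i = (i == ord0) * N :> nat.
  by apply: mkT; rewrite (bigD1 ord0)//= mul1n big1 ?addn0// => i /negbTE ->.
pose rk (i : 'I_n.+1) (x : T) : nat := val x i * #|T| + enum_rank x.
have rk_le i x y : rk i y <= rk i x -> val y i <= val x i.
  move=> yx; rewrite leqNgt; apply/negP => xy; move: yx; apply/negP.
  rewrite -ltnNge; apply: (@leq_trans ((val x i).+1 * #|T|)).
    by rewrite /rk mulSn [ltnRHS]addnC ltn_add2l; exact: ltn_ord.
  by apply: leq_trans (leq_addr _ _); rewrite leq_mul2r xy orbT.
have rk_inj i : injective (rk i).
  move=> x y rxy; have exy : val x i = val y i :> nat.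
    by apply/eqP; rewrite eqn_leq !rk_le ?rxy.
  by move: rxy; rewrite /rk exy => /addnI/ord_inj/enum_rank_inj.
have [C [s [Cs dom]]] := @Scarf T 'I_n.+1 x0 ord0 rk (c \o val) rk_inj.
have [i1 i1C _] := dom x0.
have [x1 x1s _] := Cs i1 i1C.
pose m i : nat := val [arg min_(x < x1 in s) val x i : nat] i.
have mle x i : x \in s -> m i <= val x i.
  by rewrite /m; case: arg_minnP => // z _ H /H.
have mE i : exists2 x, x \in s & m i = val x i.
  by rewrite /m; case: arg_minnP => // z zs _; exists z.
have mN : N < \sum_(i in C) (m i).+1.
  rewrite ltnNge; apply/negP => leN.
  (* Otherwise this lattice point, with the surplus placed on [i1] in [C], would exceed the minima
     in every order of [C], against dominance. *)
  pose F i := (i \in C) * (m i).+1 + (i == i1) * (N - \sum_(i in C) (m i).+1).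
  have [y yF] : exists y : T, forall i, val y i = F i :> nat.
    apply: mkT; rewrite big_split /=.
    rewrite [X in _ + X](bigD1 i1)//= eqxx mul1n [X in _ + (_ + X)]big1 ?addn0.
      rewrite (eq_bigr (fun i => if i \in C then (m i).+1 else 0)).
        by rewrite -big_mkcond subnKC.
      by move=> i _; case: (i \in C); rewrite ?mul1n.
    by move=> i /negbTE ->.
  have [i iC yle] := dom y; have [x xs mx] := mE i.
  by have := rk_le _ _ _ (yle x xs); rewrite -mx yF /F iC mul1n addSn ltnNge leq_addr.
pose b i := if i \in C then m i else 0.
(* The excesses over [b] sum to [N] minus the minima over [C], which is less than [#|C|] by [mN]. *)
have sub_le x i : x \in s -> val x i - b i <= n.+1.
  move=> xs; have bx j : b j <= val x j by rewrite /b; case: ifP => // _; exact: mle.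
  have : \sum_j (val x j - b j) <= n.+1.
    have /eqP sx := valP x; rewrite -(leq_add2l (\sum_j b j)) -big_split /=.
    rewrite (eq_bigr (fun j => val x j : nat)) => [|j _]; last by rewrite subnKC.
    rewrite sx ltnW//; apply: leq_trans mN _.
    rewrite /b -big_mkcond /=; under eq_bigr do rewrite -addn1.
    by rewrite big_split /= leq_add2l sum1_card -[leqRHS]card_ord max_card.
  by apply: leq_trans; rewrite (bigD1 i)//= leq_addr.
have xle x y i : x \in s -> y \in s -> val x i <= val y i + n.+1.
  move=> xs ys; have := sub_le x i xs; rewrite leq_subLR => /leq_trans; apply.
  by rewrite leq_add2r /b; case: ifP => // _; exact: mle.
exists C, (val x1); split; first exact/eqP/(valP x1).
  by move=> i iC; have := sub_le x1 i x1s; rewrite /b (negbTE iC) subn0.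
move=> i /Cs[y ys cy]; exists (val y); split => //; first exact/eqP/(valP y).
by move=> j; rewrite !xle.
Qed.

Require Import Defs.
From mathcomp Require Import all_boot all_order all_algebra.
From mathcomp Require Import all_classical all_reals all_analysis.
From mathcomp Require Import measurable_realfun lra.

Import Order.TTheory GRing.Theory Num.Theory.
Import numFieldNormedType.Exports.
Local Open Scope classical_set_scope.
Local Open Scope ring_scope.

(** * The dual KKM lemma *)

Section KKM.
Variables (R : realType) (n : nat).
Implicit Types p : 'rV[R]_n.+1.

Definition simplex : set 'rV[R]_n.+1 :=
  [set p | (forall i, 0 <= p ord0 i) /\ \sum_i p ord0 i = 1].

Lemma simplex_le1 p i : simplex p -> p ord0 i <= 1.
Proof. by move=> [p0 <-]; rewrite (bigD1 i)//= lerDl sumr_ge0. Qed.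

Lemma compact_simplex : compact simplex.
Proof.
pose box := [set p : 'rV[R]_n.+1 | forall i, [set` `[0 : R, 1]] (p ord0 i)].
apply: (@subclosed_compact _ _ box).
- rewrite (_ : simplex = \bigcap_i [set p | 0 <= p ord0 i] `&`
    [set p | \sum_i p ord0 i = 1]); last first.
    by apply/seteqP; split => [p [p0 p1]|p [p0 p1]]; split => // i *; apply: p0.
  apply: closedI.
    apply: closed_bigI => i _.
    apply: (@preimage_closed _ _ (fun p : 'rV[R]_n.+1 => p ord0 i)
      [set x | 0 <= x]) => //.
    by move=> p _; exact: coord_continuous.
  apply: (@preimage_closed _ _ (fun p : 'rV[R]_n.+1 => \sum_i p ord0 i)
    [set x | x = 1]) => //.
  move=> p _; apply: continuous_big => [|i _]; last exact: coord_continuous.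
  exact: add_continuous.
- by apply: (@rV_compact R n.+1 (fun=> [set` `[0 : R, 1]])) => i; exact: segment_compact.
- by move=> p sp i /=; rewrite in_itv /= simplex_le1 // (proj1 sp).
Qed.

Lemma cluster_seq_nbhs (T : topologicalType) (u : nat -> T) (x : T) (U : set T) m :
  cluster (u @ \oo) x -> nbhs x U -> exists2 N, (m <= N)%N & U (u N).
Proof.
move=> /(_ [set u N | N in [set N | (m <= N)%N]] U) H /H.
case; first by exists m => // N /= mN; exists N.
by move=> _ [[N mN <-] UN]; exists N.
Qed.

(** Each lattice point is coloured by a set containing it. [Scarf_lattice] then gives points all of
    whose coordinates above the mesh satisfy the conclusion up to the mesh; closedness of the sets
    transfers this to a cluster point. *)
Lemma KKM_dual (A : 'I_n.+1 -> set 'rV[R]_n.+1) : (forall i, closed (A i)) ->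
  (forall p, simplex p -> exists i, A i p) ->
  exists2 p, simplex p & forall i, 0 < p ord0 i -> A i p.
Proof.
move=> clA covA.
pose mesh N : R := n.+1%:R / N.+1%:R.
have approx N : exists p, simplex p /\ forall i, mesh N < p ord0 i ->
    exists2 y, A i y & forall j, `|p ord0 j - y ord0 j| <= mesh N.
  pose pt (x : {ffun 'I_n.+1 -> 'I_N.+2}) : 'rV[R]_n.+1 :=
    \row_j ((x j)%:R / N.+1%:R).
  have Npos : 0 < N.+1%:R :> R by rewrite ltr0n.
  have pt_simplex (x : {ffun 'I_n.+1 -> 'I_N.+2}) :
      (\sum_i x i = N.+1)%N -> simplex (pt x).
    move=> sx; split => [i|]; first by rewrite mxE divr_ge0.
    under eq_bigr do rewrite mxE.
    by rewrite -mulr_suml -natr_sum sx divff// gt_eqF.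
  have /choice[c cP] : forall x : {ffun 'I_n.+1 -> 'I_N.+2}, exists i,
      (\sum_i x i = N.+1)%N -> A i (pt x).
    move=> x; have [/pt_simplex/covA[i Ai]|] := eqVneq (\sum_i x i)%N N.+1.
      by exists i.
    by move=> sx; exists ord0 => sx'; rewrite sx' eqxx in sx.
  have [C [x [sx xC Cx]]] := Scarf_lattice c.
  exists (pt x); split; first exact: pt_simplex.
  move=> i; rewrite mxE /mesh ltr_pM2r ?invr_gt0// ltr_nat ltnNge => xi.
  have /Cx[y [sy cy xy]] : i \in C by apply: contraR xi => /xC.
  exists (pt y); first by rewrite -cy; exact: cP.
  move=> j; rewrite !mxE -mulrBl normrM [`|_^-1|]ger0_norm ?invr_ge0//.
  rewrite ler_pM2r ?invr_gt0// ler_norml lerBlDr lerNl opprB lerBlDr -!natrD !ler_nat.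
  by rewrite ![(n.+1 + _)%N]addnC; have /andP[-> ->] := xy j.
have [u uP] := choice approx.
have [|p [sp clp]] := @compact_simplex (u @ \oo) _.
  by exists 0%N => // N _; have [] := uP N.
exists p => // i pi; apply: clA => U /nbhs_ballP[e /= e0 eU].
(* One half of [e] is spent on each leg from [p] through [u N] to [y]; half of the coordinate of [p]
   keeps that of [u N] above the mesh. *)
pose d := Num.min (e / 2) (p ord0 i / 2).
have d0 : 0 < d by rewrite lt_min !divr_gt0.
have [m mP] : exists m, forall N, (m <= N)%N -> mesh N < d.
  have [m _ mP] : \forall N \near \oo, mesh N < d.
    have : mesh N @[N --> \oo] --> (0 : R).
      by rewrite -(mulr0 n.+1%:R); apply: cvgMl_tmp; exact: cvg_harmonic.
    by move=> /cvgr_lt; exact.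
  by exists m.
have [N /mP mN [_ uN]] := cluster_seq_nbhs m clp (nbhsx_ballx p d d0).
have uN' j : `|p ord0 j - u N ord0 j| < d by exact: uN.
have [_] := uP N => /(_ i); case.
  apply: lt_trans mN _.
  have := ltr_distlDr (uN' i); have : d <= p ord0 i / 2 by rewrite /d ge_min lexx orbT.
  lra.
move=> y Ay uy; exists y; split => //; apply: eU; split => // i' j; rewrite ord1 /ball /=.
have de : d <= e / 2 by rewrite /d ge_min lexx.
have := ler_distD (u N ord0 j) (p ord0 j) (y ord0 j).
have := uy j; have := uN' j; lra.
Qed.
End KKM.

(** * Countable products and the Cantor space *)

Lemma cvg_prod_topology (I : Type) (T : I -> topologicalType)
    (F : set_system (prod_topology T)) (f : prod_topology T) : Filter F ->
  (forall i, g i @[g --> F] --> f i) -> F --> f.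
Proof.
move=> FF cvgF; apply/cvg_sup => i U /=.
rewrite (@nbhsE (initial_topology (fun g : prod_topology T => g i))).
move=> [_ [[B oB <-] Bf] BU]; apply: filterS BU _.
by apply: (cvgF i); apply: open_nbhs_nbhs.
Qed.

(** Otherwise counterexamples constrained in more and more coordinates would converge to [f] while
    staying outside [A]. *)
Lemma nbhs_prod_countable (I : countType) (T : I -> topologicalType)
    (f : prod_topology T) (B : forall i, nat -> set (T i)) (A : set (prod_topology T)) :
  (forall i U, nbhs (f i) U -> \forall n \near \oo, B i n `<=` U) ->
  nbhs f A ->
  exists n, forall g, (forall i, (pickle i < n)%N -> B i n (g i)) -> A g.
Proof.
move=> Bbase fA; apply: contrapT => /forallNP noN.
have /choice[g gP] : forall n, exists g : prod_topology T,
    (forall i, (pickle i < n)%N -> B i n (g i)) /\ ~ A g.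
  by move=> n; have /existsNP[g] := noN n; rewrite not_implyE => ?; exists g.
have : g n @[n --> \oo] --> f.
  apply: cvg_prod_topology => i U /Bbase BU.
  change (\forall n \near \oo, U (g n i)); near=> n; have BUn : B i n `<=` U by near: n.
  apply: BUn; apply: (gP n).1; near: n; exact: nbhs_infty_gt.
move=> /(_ A fA) [n _ /(_ n (leqnn n))] /=.
by have [] := gP n.
Unshelve. all: by end_near. Qed.

Lemma nbhs_cantor (c : cantor_space) (A : set cantor_space) : nbhs c A ->
  exists n, forall c' : cantor_space, (forall k, (k < n)%N -> c' k = c k) -> A c'.
Proof.
move=> /(@nbhs_prod_countable nat (fun=> bool) c (fun i _ => [set c i]) A)[|n nA].
  by move=> i U /nbhs_singleton Uci; near=> k => _ ->.
by exists n => c' cc'; apply: nA => k; exact: cc'.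
Unshelve. all: by end_near. Qed.

Section continuity_prod.
Variables (R : realType) (I : countType).
Let RI := prod_topology (fun _ : I => R).

(** The product is first countable: boxes of radius [n.+1%:R^-1] in the coordinates of code below
    [n] yield a sequence refuting continuity if it fails. *)
Lemma seq_continuous_prod (G : RI -> R) :
  (forall (t : nat -> RI) (t0 : RI), (forall i, t n i @[n --> \oo] --> t0 i) ->
     G (t n) @[n --> \oo] --> G t0) ->
  continuous G.
Proof.
move=> seqG t0 U GU; apply: contrapT => nU.
have box n e : 0 < e ->
    nbhs t0 [set t : RI | forall i, (pickle i < n)%N -> ball (t0 i) e (t i)].
  move=> e0; elim: n => [|n IHn]; first exact: filterS filterT.
  case Ei : (@pickle_inv I n) => [i|].
    have ni : nbhs t0 [set t : RI | ball (t0 i) e (t i)].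
      by apply: (@proj_continuous I (fun=> R) i t0); exact: nbhsx_ballx.
    apply: filterS (filterI IHn ni) => t [tn ti] j.
    rewrite ltnS leq_eqVlt => /orP[/eqP jn|/tn//].
    by move: Ei; rewrite -jn pickleK_inv => -[->].
  apply: filterS IHn => t tn j.
  rewrite ltnS leq_eqVlt => /orP[/eqP jn|/tn//].
  by move: Ei; rewrite -jn pickleK_inv.
have /choice[t tP] : forall n, exists t : RI,
    (forall i, (pickle i < n)%N -> ball (t0 i) n.+1%:R^-1 (t i)) /\ ~ U (G t).
  move=> n; apply: contrapT => /forallNP H; apply: nU.
  have n0 : 0 < n.+1%:R^-1 :> R by rewrite invr_gt0.
  apply: filterS (box n _ n0) => t Bt; apply: contrapT => Ut.
  exact: (H t).
have /seqG : forall i, t n i @[n --> \oo] --> t0 i.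
  move=> i V /nbhs_ballP[e /= e0 eV].
  change (\forall n \near \oo, V (t n i)); near=> n.
  apply: eV; apply: (@le_ball _ _ _ n.+1%:R^-1); last first.
    by apply: (tP n).1; near: n; exact: nbhs_infty_gt.
  by near: n; apply: (cvgr_le _ (@cvg_harmonic R)).
move=> /(_ U GU) [n _ /(_ n (leqnn n))] /=.
by have [] := tP n.
Unshelve. all: by end_near. Qed.

End continuity_prod.

(** * Coding real numbers by thresholds on the binary tree *)

Section coding.
Variable R : realType.
Implicit Types (t : seq bool -> R) (u : R).

(* The thresholds [t] at the nodes of the binary tree turn a number [u] into an
   infinite binary word: the bit following the prefix [w] is [t w <= u]. *)
Fixpoint code_prefix t u n : seq bool :=
  if n is m.+1 then
    let w := code_prefix t u m in rcons w (t w <= u)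
  else [::].

Definition code t u : cantor_space := fun n => t (code_prefix t u n) <= u.

Lemma code_prefixE t u n : code_prefix t u n = mkseq (code t u) n.
Proof. by elim: n => [//|n IHn]; rewrite mkseqS -IHn. Qed.

Lemma measurable_code_prefix t n w : measurable [set u | code_prefix t u n = w].
Proof.
elim: n w => [|n IHn] w /=.
  have [<-|w0] := eqVneq [::] w.
    by rewrite (_ : mkset _ = setT)//; apply/seteqP; split.
  rewrite (_ : mkset _ = set0)//; apply/seteqP; split => // u /= w0'.
  by rewrite w0' eqxx in w0.
case/lastP: w => [|w b].
  rewrite (_ : mkset _ = set0)//; apply/seteqP; split => // u /=.
  by case: (code_prefix t u n).
rewrite (_ : mkset _ = [set u | code_prefix t u n = w] `&`
    (if b then [set` `[t w, +oo[] else [set` `]-oo, t w[])).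
  by apply: measurableI => //; case: b.
apply/seteqP; split => u /=.
  move=> /rcons_inj[<-]; case: b => /=; rewrite in_itv /= ?andbT => //.
  by move/negbT; rewrite -ltNge.
move=> [<-]; case: b; rewrite /= in_itv /= ?andbT; first by move=> ->.
by rewrite leNgt => ->.
Qed.

Lemma measurable_fun_code d (T : borelMetricType d R) (f : cantor_space -> T) t :
  continuous f -> @measurable_fun _ _ (measurableTypeR R) T setT (f \o code t).
Proof.
move=> cf; apply: (measurability (@open T)).
  exact: borel_measurableE.
move=> _ [V oV <-].
rewrite setTI.
(* The words whose cylinder [f] maps into [V]: the preimage of [V] is a countable union of such
   cylinders. *)
pose W := [set w : seq bool |
  [set c : cantor_space | mkseq c (size w) = w] `<=` f @^-1` V].
rewrite (_ : _ @^-1` _ = \bigcup_(w in W) [set u | code_prefix t u (size w) = w]).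
  rewrite bigcup_mkcond; apply: countable_bigcupT_measurable => // w.
  by case: ifP => // _; exact: measurable_code_prefix.
apply/seteqP; split => u /=.
  move=> Vfu; have [|n cn] := @nbhs_cantor (code t u) (f @^-1` V).
    by apply: cf; apply: open_nbhs_nbhs.
  exists (mkseq (code t u) n).
    move=> c /= cE; apply: cn => k kn.
    have := congr1 (nth false ^~ k) cE; rewrite size_mkseq !nth_mkseq//.
  by rewrite /= size_mkseq code_prefixE.
by move=> [w Ww /=]; rewrite code_prefixE => /Ww.
Qed.

(** A strict inequality between [t0 w] and [u] persists along the sequence, so every finite prefix
    is eventually constant; a bit could jump only where [t0 w = u]. *)
Lemma cvg_code (t : nat -> seq bool -> R) (t0 : seq bool -> R) u :
  (forall w, t n w @[n --> \oo] --> t0 w) -> (forall w, t0 w != u) ->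
  code (t n) u @[n --> \oo] --> (code t0 u : cantor_space).
Proof.
move=> tt0 t0u.
have t_le w : \forall n \near \oo, (t n w <= u) = (t0 w <= u).
  have [t0w|ut0] := leP (t0 w) u.
    have t0w' : t0 w < u by rewrite lt_neqAle t0u.
    near=> n; apply/idP/ltW; near: n; exact: (cvgr_lt _ (tt0 w)).
  near=> n; apply/negbTE; rewrite -ltNge; near: n; exact: (cvgr_gt _ (tt0 w)).
have prefix_eq m : \forall n \near \oo, code_prefix (t n) u m = code_prefix t0 u m.
  elim: m => [|m IHm]; first by near=> n.
  near=> n => /=; have -> : code_prefix (t n) u m = code_prefix t0 u m by near: n.
  by congr rcons; near: n; exact: t_le.
apply: (@cvg_prod_topology nat (fun=> bool)) => i U /nbhs_singleton Ui.
change (\forall n \near \oo, U (code (t n) u i)); near=> n.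
have : code_prefix (t n) u i.+1 = code_prefix t0 u i.+1 by near: n.
by move=> /= /rcons_inj[_]; rewrite /code => ->.
Unshelve. all: by end_near. Qed.

End coding.

(** * Wasserstein continuity *)

Section mdist.
Variables (R : realType) (d : measure_display) (T : borelMetricType d R).

Lemma continuous_mdist (x : T) : continuous (mdist x : T -> R).
Proof.
move=> y; apply/cvgrPdist_lt => e e0.
apply: (@filterS _ _ _ (ball y e)); last exact: nbhsx_ballx.
move=> z; rewrite ballEmdist /= => yz; apply: le_lt_trans yz.
have := metric_triangle x y z; have := metric_triangle x z y.
rewrite (metric_sym z y) ler_norml; lra.
Qed.

Lemma mdist_bounded : compact [set: T] ->
  exists M : R, forall x y : T, mdist x y <= M.
Proof.
move=> cT; have : compact (mdist (point : T) @` [set: T]).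
  apply: continuous_compact => //; apply: continuous_subspaceT.
  exact: continuous_mdist.
move=> /compact_bounded[M [_ /(_ (M + 1))]].
rewrite ltrDl ltr01 => /(_ isT) Mbound.
have le_point (x : T) : mdist point x <= M + 1.
  by apply: le_trans (Mbound _ _); [exact: ler_norm|exists x].
exists ((M + 1) + (M + 1)) => x y; apply: le_trans (metric_triangle x point y) _.
by rewrite lerD// metric_sym.
Qed.

(** The images of the eventually false words form a countable dense set, and each sublevel set of
    the distance is a countable union of products of balls centred there. *)
Lemma measurable_mdist (f : cantor_space -> T) : continuous f ->
  set_surj [set: cantor_space] [set: T] f ->
  measurable_fun [set: T * T] (fun z : T * T => mdist z.1 z.2 : R).
Proof.
move=> cf sf; apply: (measurability (@RGenInftyO.G R)).
  exact: RGenInftyO.measurableE.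
move=> _ [_ [r ->] <-]; rewrite setTI.
pose e n : R := n.+1%:R^-1.
pose q (w : seq bool) : T := f (nth false w).
pose F (wn : seq bool * nat) := [set x | mdist (q wn.1) x < e wn.2] `*`
  [set y | mdist (q wn.1) y < r - e wn.2].
have open_lt (x : T) (s : R) : measurable [set y | mdist x y < s].
  rewrite borel_measurableE; apply: sub_sigma_algebra.
  apply: (@open_comp _ _ (mdist x) [set z : R | z < s]); last exact: open_lt.
  by move=> y _; exact: continuous_mdist.
rewrite (_ : _ @^-1` _ = \bigcup_wn F wn).
  apply: countable_bigcupT_measurable => // wn; exact: measurableX.
apply/seteqP; split => -[x y]; rewrite /= in_itv /=.
  move=> xyr.
  have [n ne] : exists n, e n < (r - mdist x y) / 2.
    have : \forall n \near \oo, e n < (r - mdist x y) / 2.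
      apply: (cvgr_lt _ (@cvg_harmonic R)); lra.
    by move=> [n _ /(_ n (leqnn n))]; exists n.
  have [c _ fc] := sf x I.
  have [|m cm] := @nbhs_cantor c (f @^-1` (ball x (e n))).
    by apply: cf; rewrite fc; apply: nbhsx_ballx; rewrite invr_gt0.
  exists (mkseq c m, n) => //; rewrite /F /=.
  have : ball x (e n) (q (mkseq c m)).
    by apply: cm => k km; rewrite nth_mkseq.
  rewrite ballEmdist /= metric_sym => qx; split => //.
  have := metric_triangle (q (mkseq c m)) x y; lra.
move=> [[w n] _ [/= xw yw]].
have := metric_triangle x (q w) y; rewrite (metric_sym x (q w)); lra.
Qed.

End mdist.

Section wasserstein.
Variables (R : realType) (d d' : measure_display) (T : borelMetricType d R).
Variables (Om : measurableType d') (P : probability Om R).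
Hypothesis mdist_meas : measurable_fun [set: T * T] (fun z : T * T => mdist z.1 z.2 : R).
Local Open Scope ereal_scope.

(** The joint law of [X] and [Y] is a coupling of their laws. *)
Lemma W1_distribution_le (X Y : {mfun Om >-> T}) :
  W1 (distribution P X) (distribution P Y) <= \int[P]_w (mdist (X w) (Y w))%:E.
Proof.
have mXY : measurable_fun [set: Om] (fun w => (X w, Y w)).
  by apply: measurable_fun_pair.
pose Z : {mfun Om >-> (T * T)%type} := mfun_Sub (mem_set mXY).
apply: ereal_inf_lbound; exists (distribution P Z).
  move=> A mA; split; rewrite /distribution /pushforward /=; congr (P _);
    by apply/seteqP; split => w //= [].
rewrite ge0_integral_distribution//=.
- exact/measurable_EFinP.
- by move=> z; rewrite lee_fin mdist_ge0.
Qed.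

Lemma cvg_W1_distribution (X : nat -> {mfun Om >-> T}) (X0 : {mfun Om >-> T}) (M : R) :
  (forall x y : T, (mdist x y <= M)%R) ->
  {ae P, forall w, X n w @[n --> \oo] --> X0 w} ->
  forall e : R, (0 < e)%R ->
  \forall n \near \oo, W1 (distribution P X0) (distribution P (X n)) < e%:E.
Proof.
move=> dM XX0 e e0.
have mf (A B : {mfun Om >-> T}) : measurable_fun [set: Om]
    (fun w => (mdist (A w) (B w))%:E : \bar R).
  apply/measurable_EFinP.
  have mAB : measurable_fun [set: Om] (fun w => (A w, B w)).
    exact: measurable_fun_pair.
  exact: (measurableT_comp mdist_meas mAB).
have [|||||_ _] := @dominated_convergence _ _ _ P setT measurableT
  (fun n w => (mdist (X0 w) (X n w))%:E) (cst 0) (cst M%:E).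
- by move=> n; exact: mf.
- exact: measurable_cst.
- apply: filterS XX0 => w Xw _; apply: cvg_EFin; first by near=> n.
  apply/cvgrPdist_lt => r r0.
  apply: filterS ((metricType_numDomainType.cvgrPdist_lt _ _).1 Xw r r0) => n.
  by rewrite sub0r normrN ger0_norm// mdist_ge0.
- exact: finite_measure_integrable_cst.
- by apply: aeW => w n _; rewrite gee0_abs ?lee_fin// mdist_ge0.
rewrite integral0 => /= cvg0.
have : \forall n \near \oo, \int[P]_w (mdist (X0 w) (X n w))%:E < e%:E.
  have e0' : 0 < e%:E by rewrite lte_fin.
  exact: (cvg0 _ (open_ereal_lt' e0')).
move=> H; apply: filterS H => n ne.
by apply: le_lt_trans ne; exact: W1_distribution_le.
Unshelve. all: by end_near. Qed.
End wasserstein.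

(** * Laws of coded random points *)

Section code_law.
Variables (R : realType) (d : measure_display) (T : borelMetricType d R).
Variables (f : cantor_space -> T) (cf : continuous f).

Let unif : probability (measurableTypeR R) R := uniform_prob (@ltr01 R).

Definition code_fun (t : seq bool -> R) : {mfun measurableTypeR R >-> T} :=
  @mfun_Sub _ _ (measurableTypeR R) T (f \o code t) (mem_set (measurable_fun_code t cf)).

Definition code_law (t : seq bool -> R) : probability T R :=
  distribution unif (code_fun t).

Lemma cvg_code_law (t : nat -> seq bool -> R) (t0 : seq bool -> R) :
  compact [set: T] -> set_surj [set: cantor_space] [set: T] f ->
  (forall w, t n w @[n --> \oo] --> t0 w) ->
  forall e : R, 0 < e ->
  \forall n \near \oo, (W1 (code_law t0) (code_law (t n)) < e%:E)%E.
Proof.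
move=> cT sf tt0; have [M dM] := mdist_bounded cT.
apply: (cvg_W1_distribution (measurable_mdist cf sf) dM).
(* Codes may fail to converge only at values of [t0], a countable and hence null set. *)
have cntN : countable (range t0).
  by apply: (sub_countable (card_image_le _ _)); exact: countableP.
have mN : measurable (range t0).
  by apply: countable_measurable => // x; exact: measurable_set1.
exists (range t0); split => //.
  have := dominates_uniform_prob (@ltr01 R) => /null_content_dominatesP; apply => //.
  exact: countable_lebesgue_measure0.
move=> u /= nu; apply: contrapT => ut0; apply: nu.
apply: continuous_cvg; first exact: cf.
apply: cvg_code => // w; apply/eqP => tw; apply: ut0; by exists w.
Qed.

Lemma unif_itv (a b : R) : 0 <= a -> a <= b -> b <= 1 ->
  unif `[a, b[%classic = (b - a)%:E.
Proof.
move=> a0 ab b1.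
have -> : unif `[a, b[%classic =
  (\int[lebesgue_measure]_(u in `[a, b[) (uniform_pdf 0 1 u)%:E)%E by [].
rewrite (eq_integral (cst 1%E)); last first.
  move=> u; rewrite inE /= in_itv /= => /andP[au ub].
  rewrite /uniform_pdf (le_trans a0 au) (ltW (lt_le_trans ub b1)) /=.
  by rewrite subr0 invr1.
rewrite integral_cst//= mul1e lebesgue_measure_itv /= lte_fin.
have [->|ab'] := eqVneq a b; first by rewrite ltxx subrr.
by rewrite lt_neqAle ab' ab -EFinB.
Qed.

Definition lexlt (c c' : nat -> bool) :=
  exists n, [/\ forall k, (k < n)%N -> c k = c' k, ~~ c n & c' n].

Section finite.
Variables (n : nat) (c : 'I_n -> cantor_space) (p : 'I_n -> R).
Hypothesis c_inj : injective c.
Hypotheses (p_ge0 : forall i, 0 <= p i) (p_sum1 : \sum_i p i = 1).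

(** The left-continuous distribution function of the weights [p] on the points [c i], in
    lexicographic order. *)
Let mass (z : nat -> bool) : R := \sum_i p i *+ `[< lexlt (c i) z >].

(* Among the words with prefix [w], those whose next bit is [false] are the ones
   lexicographically before [w] followed by 1, 0, 0, ... *)
Definition threshold (w : seq bool) : R := mass (nth false (rcons w true)).

Lemma threshold_itv w : threshold w \in `[0, 1].
Proof.
rewrite in_itv /=; apply/andP; split.
  by apply: sumr_ge0 => i _; rewrite mulrn_wge0.
rewrite -p_sum1; apply: ler_sum => i _.
by case: asboolP => _ //; rewrite mulr0n.
Qed.

Lemma lexlt_irr z : ~ lexlt z z.
Proof. by move=> [m [_ /negP]]. Qed.

(** Coding is a quantile transform. At a prefix of [c i] followed by bit 1, the threshold counts
    only points before [c i], so it is at most [u]; if the bit is 0 it counts those and [c i]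
    itself, so it exceeds [u]. *)
Lemma code_threshold i u : mass (c i) <= u < mass (c i) + p i ->
  code threshold u = c i.
Proof.
move=> /andP[iu ui].
have code_n m : code_prefix threshold u m = mkseq (c i) m -> code threshold u m = c i m.
  move=> pE; rewrite /code pE /threshold; set z := nth false _.
  have z_lt k : (k < m)%N -> z k = c i k.
    by move=> km; rewrite /z nth_rcons size_mkseq km nth_mkseq.
  have z_m : z m = true by rewrite /z nth_rcons size_mkseq ltnn eqxx.
  have z_gt k : (m < k)%N -> z k = false.
    by move=> mk; rewrite /z nth_rcons size_mkseq ltnNge (ltnW mk) gtn_eqF.
  have [cim|/negbTE cim] := boolP (c i m).
    apply: le_trans iu; apply: ler_sum => j _; apply: ler_wpMn2l => //.
    case: asboolP => // -[k [jk njk zk]]; rewrite asboolT//.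
    have km : (k <= m)%N by rewrite leqNgt; apply: contraTN zk => /z_gt ->.
    exists k; split => // [l lk|]; first by rewrite jk// z_lt// (leq_trans lk km).
    by move: km; rewrite leq_eqVlt => /orP[/eqP -> //|km]; rewrite -z_lt.
  apply/negbTE; rewrite -ltNge; apply: lt_le_trans ui _.
  rewrite /mass (bigD1 i)//= [leRHS](bigD1 i)//=.
  rewrite asboolF; last exact: lexlt_irr.
  rewrite asboolT; last first.
    by exists m; split; [move=> k km; rewrite z_lt|rewrite cim|].
  rewrite /= mulr0n add0r mulr1n [leLHS]addrC lerD2l.
  apply: ler_sum => j _; apply: ler_wpMn2l => //.
  case: asboolP => // -[k [jk njk ik]]; rewrite asboolT//.
  have [km|mk|km] := ltngtP k m.
  - exists k; split => // [l lk|]; last by rewrite z_lt.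
    by rewrite jk// z_lt// (ltn_trans lk km).
  - exists m; split => // [l lm|]; last by rewrite jk// cim.
    by rewrite jk ?z_lt// (ltn_trans lm mk).
  - by rewrite km cim in ik.
apply/funext => m; apply: (code_n).
by elim: m => [//|m IHm] /=; rewrite mkseqS -(code_n _ IHm) /code IHm.
Qed.

Lemma code_law_finite (A : set T) : measurable A ->
  code_law threshold A = (\sum_(i < n) (p i)%:E * \d_(f (c i)) A)%E.
Proof.
pose J i := `[mass (c i), mass (c i) + p i[%classic : set (measurableTypeR R).
have mass_ge0 z : 0 <= mass z by apply: sumr_ge0 => i _; rewrite mulrn_wge0.
have mass_le1 i : mass (c i) + p i <= 1.
  rewrite -p_sum1 /mass (bigD1 i)//= asboolF; last exact: lexlt_irr.
  rewrite mulr0n add0r addrC [leRHS](bigD1 i)//= lerD2l; apply: ler_sum => j _.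
  by case: asboolP => // _; rewrite mulr0n.
have mJ i : measurable (J i) by exact: measurable_itv.
have codeJ i u : J i u -> code threshold u = c i.
  by rewrite /J /= in_itv /=; exact: code_threshold.
have tJ : trivIset setT J.
  move=> i j _ _ [u [/codeJ ui /codeJ]]; rewrite ui; exact: c_inj.
(* The lower bound suffices: apply it to [A] and to its complement. *)
have ge (B : set T) : measurable B ->
    (\sum_(i < n) (p i)%:E * \d_(f (c i)) B <= code_law threshold B)%E.
  move=> mB.
  have -> : (\sum_(i < n) (p i)%:E * \d_(f (c i)) B =
      unif (\big[setU/set0]_(i < n | f (c i) \in B) J i))%E.
    rewrite measure_bigsetU_ord// [RHS]big_mkcond /=; apply: eq_bigr => i _.
    rewrite unif_itv ?lerDl// [_ + _ - _]addrC addKr diracE.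
    by case: ifP => _; rewrite ?mule1 ?mule0.
  apply: le_measure; rewrite ?inE.
  - exact: bigsetU_measurable.
  - exact: (measurable_funPTI (code_fun threshold)).
  - rewrite -bigcup_seq_cond => u [i /= /andP[_ iB] /codeJ ui].
    by move: iB; rewrite inE /= ui.
move=> mA; apply/eqP; rewrite eq_le ge// andbT.
have := ge _ (measurableC mA); rewrite probability_setC//.
have /fineK <- : code_law threshold A \is a fin_num by exact: fin_num_measure.
have sE (B : set T) : (\sum_(i < n) (p i)%:E * \d_(f (c i)) B =
    (\sum_(i < n) p i * (f (c i) \in B)%:R)%:E)%E.
  by rewrite -sumEFin; apply: eq_bigr => i _; rewrite diracE EFinM.
rewrite !sE -EFinB !lee_fin.
suff : \sum_(i < n) p i * (f (c i) \in ~` A)%:R +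
  \sum_(i < n) p i * (f (c i) \in A)%:R = 1 by lra.
rewrite -big_split -[RHS]p_sum1 /=; apply: eq_bigr => i _.
by rewrite -mulrDr in_setC; case: (_ \in A); rewrite /= ?add0r ?addr0 mulr1.
Qed.

End finite.
End code_law.

(** * Rejection probabilities *)

Lemma integrable_01 (R : realType) (d : measure_display) (X : measurableType d)
    (m : {measure set X -> \bar R}) (h : X -> R) :
  m setT = 1%E -> measurable_fun setT h -> (forall x, 0 <= h x <= 1) ->
  m.-integrable setT (EFin \o h).
Proof.
move=> m1 mh h01; apply: measurable_bounded_integrable => //.
  by rewrite -[ltLHS]/(m setT) m1 ltry.
exists 1; split; first exact: num_real.
move=> M M1 x _ /=; have /andP[h0 h1] := h01 x.
by rewrite ger0_norm// (le_trans h1)// ltW.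
Qed.

Section density.
Variables (R : realType) (d : measure_display) (X : measurableType d).
Local Open Scope ereal_scope.

(** The Radon-Nikodym derivative of [mu] agrees with [g] almost everywhere, since both have the same
    integral over every measurable set. *)
Lemma ge0_integral_density (mu : probability X R)
    (nu : {sigma_finite_measure set X -> \bar R}) (g : X -> R) (h : X -> R) :
  measurable_fun setT g -> (forall x, 0 <= g x)%R ->
  (forall A, measurable A -> mu A = \int[nu]_(x in A) (g x)%:E) ->
  measurable_fun setT h -> (forall x, 0 <= h x <= 1)%R ->
  \int[mu]_x (h x)%:E = \int[nu]_x (h x * g x)%:E.
Proof.
move=> mg g0 muE mh h01.
have mG : measurable_fun setT (EFin \o g) by exact/measurable_EFinP.
have munu : mu `<< nu.
  apply/null_content_dominatesP => A mA nuA; rewrite muE//.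
  have := @integral_abs_eq0 _ _ _ nu A (EFin \o g) mA (measurable_funTS mG) nuA.
  by apply: etrans; apply: eq_integral => x _ /=; rewrite ger0_norm.
have int_h : mu.-integrable setT (EFin \o h).
  by apply: integrable_01 => //; exact: probability_setT.
rewrite -(Radon_Nikodym_change_of_variables munu measurableT int_h).
have int_rn := Radon_Nikodym_integrable (nu := charge_of_finite_measure mu) munu.
have mrn := measurable_int _ int_rn.
apply: ae_eq_integral => //.
- by apply: emeasurable_funM => //; exact/measurable_EFinP.
- by apply/measurable_EFinP; exact: measurable_funM.
apply: filterS (integral_ae_eq measurableT int_rn mG _) => [x /= rnE _|E _ mE].
  by rewrite rnE// EFinM.
by rewrite -muE//= -Radon_Nikodym_integral.
Qed.
End density.

(* [mnormalize] provides the [probability] structure that the values of a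
   probability kernel lack. *)
Lemma exists_probability (R : realType) (d : measure_display) (X : measurableType d)
    (m : {measure set X -> \bar R}) : m setT = 1%E ->
  exists mu : probability X R, forall A, mu A = m A.
Proof.
move=> m1; exists (mnormalize m \d_(point : X) : probability X R) => A.
by rewrite /= /mnormalize m1 /= gt_eqF//= invr1 mule1.
Qed.

Section finite_support.
Variables (R : realType) (d : measure_display) (T : measurableType d).
Variables (n : nat) (p : 'I_n -> R) (x : 'I_n -> T).
Local Open Scope ereal_scope.

Lemma ge0_integral_finite_support (m : {measure set T -> \bar R}) (h : T -> \bar R) :
  (forall i, 0 <= p i)%R ->
  (forall A, measurable A -> m A = \sum_(i < n) (p i)%:E * \d_(x i) A) ->
  measurable_fun setT h -> (forall t, 0 <= h t) ->
  \int[m]_t h t = \sum_(i < n) (p i)%:E * h (x i).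
Proof.
move=> p0 mE mh h0.
(* Indices beyond [n] get the zero measure, as [msum] takes a sequence over all of [nat]. *)
pose m_ (k : nat) : {measure set T -> \bar R} :=
  if insub k is Some i then mscale (NngNum (p0 i)) \d_(x i) else mzero.
have m_E (i : 'I_n) : m_ i = mscale (NngNum (p0 i)) \d_(x i).
  by rewrite /m_ valK.
rewrite (eq_measure_integral (msum m_ n)); last first.
  move=> A mA _; rewrite mE// /msum; apply: eq_bigr => i _.
  by rewrite m_E.
rewrite ge0_integral_measure_sum//; apply: eq_bigr => i _.
rewrite m_E ge0_integral_mscale// integral_dirac//.
by rewrite diracT mul1e.
Qed.

End finite_support.

Section acceptance.
Variables (R : realType) (dX dT : measure_display).
Variables (X : borelMetricType dX R) (Theta : borelMetricType dT R).
Variable tau : X -> R -> set Theta.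
Hypothesis tau_est : is_randomized_set_estimator tau.

Let I01 : set (measurableTypeR R) := `[0%R, 1%R]%classic.

(** Extension by zero outside the unit interval, so that Tonelli's theorem applies on the whole
    line. *)
Let integrand (z : Theta * X) (u : measurableTypeR R) : \bar R :=
  ((fun u => (\1_(tau z.2 u) z.1)%:E) \_ I01) u.

Let integrand_ge0 z u : (0 <= integrand z u)%E.
Proof. by rewrite /integrand patchE; case: ifP => // _; rewrite lee_fin. Qed.

Let measurable_integrand :
  measurable_fun [set: (Theta * X) * measurableTypeR R]
    (fun zu => integrand zu.1 zu.2).
Proof.
have [_ mtau] := tau_est.
pose D := [set z : Theta * X * R | z.2 \in `[0, 1]].
rewrite (_ : (fun zu => _) = (fun z => (\1_(tau z.1.2 z.2) z.1.1 : R)%:E) \_ D).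
  have mD : measurable D.
    rewrite (_ : D = setT `*` I01); last first.
      by apply/seteqP; split => z /=; [split|case].
    by apply: measurableX => //; exact: measurable_itv.
  apply/(measurable_restrictT _ mD).
  exact/measurable_EFinP.
apply/funext => z; rewrite /integrand !patchE; congr (if _ then _ else _).
Qed.

Let acceptanceE th x :
  acceptance tau th x = fine (\int[lebesgue_measure]_u integrand (th, x) u).
Proof. by rewrite /acceptance /Rintegral [in LHS]integral_mkcond. Qed.

Let integral_le1 z : (\int[lebesgue_measure]_u integrand z u <= 1)%E.
Proof.
rewrite -integral_mkcond.
have -> : 1%E = (\int[lebesgue_measure]_(u in I01) cst 1 u)%E :> \bar R.
  rewrite integral_cst; last exact: measurable_itv.
  have := lebesgue_measure_itv `[0%R : R, 1%R].
  by rewrite /= lte_fin ltr01 oppr0 adde0 mul1e => ->.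
apply: ge0_le_integral => //.
- exact: measurable_itv.
- apply/(measurable_restrictT _ (measurable_itv _)).
  exact: (measurableT_comp measurable_integrand (pair1_measurable z)).
- by move=> u _; rewrite lee_fin indicE; case: (_ \in _).
Qed.

Lemma measurable_acceptance :
  measurable_fun [set: Theta * X] (fun z => acceptance tau z.1 z.2).
Proof.
rewrite (_ : (fun z => _) = fine \o (fun z => \int[lebesgue_measure]_u integrand z u)%E).
  apply: measurableT_comp => //.
  exact: (measurable_fun_fubini_tonelli_F _ measurable_integrand).
by apply/funext => -[th x] /=; rewrite acceptanceE.
Qed.

Lemma acceptance_ge0 th x : 0 <= acceptance tau th x.
Proof. by rewrite acceptanceE fine_ge0// integral_ge0. Qed.

Lemma acceptance_le1 th x : acceptance tau th x <= 1.
Proof.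
rewrite acceptanceE -lee_fin fineK//.
rewrite ge0_fin_numE; last exact: integral_ge0.
by apply: le_lt_trans (integral_le1 _) _; exact: ltry.
Qed.

End acceptance.

Section risk.
Variables (R : realType) (dX dT : measure_display).
Variables (X : borelMetricType dX R) (Theta : borelMetricType dT R).
Variable P : R.-pker Theta ~> X.

Definition risk (tau : X -> R -> set Theta) (th : Theta) : R :=
  fine (\int[P th]_x (rejection tau th x)%:E)%E.

Section estimator.
Variable tau : X -> R -> set Theta.
Hypothesis tau_est : is_randomized_set_estimator tau.

Lemma measurable_acceptance1 th : measurable_fun setT (acceptance tau th).
Proof.
exact: (measurableT_comp (measurable_acceptance tau_est) (pair1_measurable th)).
Qed.

Lemma measurable_rejection1 th : measurable_fun setT (rejection tau th).
Proof. by apply: measurable_funB => //; exact: measurable_acceptance1. Qed.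

Lemma rejection01 th x : 0 <= rejection tau th x <= 1.
Proof.
rewrite /rejection subr_ge0 acceptance_le1//= lerBlDr lerDl.
exact: acceptance_ge0.
Qed.

Lemma integrable_rejection th : (P th).-integrable setT (EFin \o rejection tau th).
Proof.
apply: integrable_01; [exact: prob_kernel|exact: measurable_rejection1|].
exact: rejection01.
Qed.

Lemma riskE th : (\int[P th]_x (rejection tau th x)%:E = (risk tau th)%:E)%E.
Proof.
rewrite /risk fineK//.
by have := integral_fune_fin_num measurableT (integrable_rejection th).
Qed.

Lemma integral_acceptance th :
  (\int[P th]_x (acceptance tau th x)%:E = (1 - risk tau th)%:E)%E.
Proof.
rewrite EFinB -riskE -[1%:E in RHS](prob_kernel (s := P) th).
rewrite -[X in (X - _)%E]mul1e -integral_cst// -integralB//.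
- by apply: eq_integral => x _; rewrite /= /rejection -EFinB opprB addrC subrK.
- by apply: (integrable_01 (h := cst 1)) => [|//|x /=];
    [exact: prob_kernel|rewrite ler01 lexx].
- exact: integrable_rejection.
Qed.

End estimator.

(** By Bayes' formula the prior average of the acceptance probabilities equals the marginal average
    of the posterior ones, which is [1 - alpha] by credibility. Finite support turns the integrals
    over [pi] into sums. *)
Lemma risk_average (nu : {sigma_finite_measure set X -> \bar R}) (q : Theta * X -> R)
    (pi : probability Theta R) (post : R.-pker X ~> Theta) (alpha : R)
    (tau : X -> R -> set Theta) (n : nat) (p : 'I_n -> R) (th : 'I_n -> Theta) :
  alpha <= 1 -> is_density P nu q -> is_posterior P q pi post ->
  is_credible_region P pi post alpha tau ->
  (forall i, 0 <= p i) -> \sum_i p i = 1 ->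
  (forall A, measurable A -> pi A = (\sum_(i < n) (p i)%:E * \d_(th i) A)%E) ->
  \sum_i p i * risk tau (th i) = alpha.
Proof.
move=> alpha1 [mq q0 Pq] Hpost [tau_est Hcred] p0 p1 piE.
(* The density of the marginal with respect to [nu]. *)
pose m x : R := \sum_i p i * q (th i, x).
have mq1 t : measurable_fun setT (fun x => q (t, x)).
  exact: (measurableT_comp mq (pair1_measurable t)).
have mq2 x : measurable_fun setT (fun t => q (t, x)).
  exact: (measurableT_comp mq (pair2_measurable x)).
have m0 x : 0 <= m x by apply: sumr_ge0 => i _; rewrite mulr_ge0.
have mm : measurable_fun setT m.
  by apply: measurable_sum => i; apply: measurable_funM.
have margE A : measurable A -> marginal P pi A = (\sum_(i < n) (p i)%:E * P (th i) A)%E.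
  move=> mA; apply: (ge0_integral_finite_support p0 piE) => //.
  exact: measurable_kernel.
have margE' A : measurable A -> marginal P pi A = (\int[nu]_(x in A) (m x)%:E)%E.
  move=> mA; rewrite margE//.
  under eq_bigr => i _.
    rewrite Pq// -ge0_integralZl_EFin//; last 2 first.
    - by move=> x _; rewrite lee_fin.
    - by apply: measurable_funTS; exact/measurable_EFinP.
    over.
  rewrite -ge0_integral_sum//.
  - by apply: eq_integral => x _; rewrite /m -sumEFin.
  - by move=> i; apply: measurable_funTS; apply/measurable_EFinP; exact: measurable_funM.
  - by move=> i x _; rewrite lee_fin mulr_ge0.
(* The credibility equation with the denominator [m x] of the posterior cleared. *)
pose key x := \sum_i p i * (acceptance tau (th i) x * q (th i, x)) = (1 - alpha) * m x.
have key0 x : m x = 0 -> key x.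
  move=> mx; rewrite /key mx mulr0 big1// => i _.
  have : p i * q (th i, x) = 0.
    apply/eqP; rewrite eq_le mulr_ge0// andbT -mx /m (bigD1 i)//= lerDl.
    by apply: sumr_ge0 => j _; rewrite mulr_ge0.
  by rewrite mulrCA => ->; rewrite mulr0.
have key_marg : {ae marginal P pi, forall x, key x}.
  apply: filterS2 Hpost Hcred => x postE credE.
  have [/key0//|mx0] := eqVneq (m x) 0.
  have int_q B : measurable B -> (\int[pi]_(t in B) (q (t, x))%:E =
      (\sum_i p i * q (th i, x) * (th i \in B)%:R)%:E)%E.
    move=> mB; rewrite integral_mkcond (ge0_integral_finite_support p0 piE).
    - rewrite -sumEFin; apply: eq_bigr => i _; rewrite patchE.
      by case: ifP => _; rewrite ?mulr1 ?mulr0 ?EFinM ?mule0.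
    - by apply/(measurable_restrictT _ mB); exact/measurable_EFinP/measurable_funTS.
    - by move=> t; apply: erestrict_ge0 => y _; rewrite lee_fin.
  pose w i := p i * q (th i, x) / m x.
  have w0 i : 0 <= w i by rewrite divr_ge0// mulr_ge0.
  have postE' B : measurable B -> post x B = (\sum_(i < n) (w i)%:E * \d_(th i) B)%E.
    move=> mB; rewrite postE// !int_q//.
    have -> : \sum_i p i * q (th i, x) * (th i \in [set: Theta])%:R = m x.
      by apply: eq_bigr => i _; rewrite in_setT mulr1.
    rewrite inver (negbTE mx0) -EFinM mulr_suml -sumEFin; apply: eq_bigr => i _.
    by rewrite diracE -EFinM /w mulrAC.
  move: credE; rewrite (ge0_integral_finite_support w0 postE'); last 2 first.
  - apply/measurable_EFinP.
    exact: (measurableT_comp (measurable_acceptance tau_est) (pair2_measurable x)).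
  - by move=> t; rewrite lee_fin acceptance_ge0.
  under eq_bigr do rewrite -EFinM; rewrite sumEFin => -[wE].
  rewrite /key -wE mulr_suml; apply: eq_bigr => i _.
  by rewrite /w mulrAC divfK// mulrA mulrAC.
(* The exceptional set is null for the marginal [m * nu], so [m] vanishes
   [nu]-almost everywhere on it, and [key] holds where [m] vanishes. *)
have key_nu : {ae nu, forall x, key x}.
  have [N [mN N0 keyN]] := key_marg.
  have mmN : measurable_fun N (fun x => (m x)%:E).
    by apply: measurable_funTS; exact/measurable_EFinP.
  have /(ae_eq_integral_abs _ mN mmN) : (\int[nu]_(x in N) `|(m x)%:E| = 0)%E.
    rewrite -N0 margE'//; apply: eq_integral => x _.
    by rewrite gee0_abs// lee_fin.
  apply: filterS => x mx; apply: contrapT => nkey; apply: (nkey).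
  by apply: key0; have := mx (keyN _ nkey) => -[].
have macc i := measurable_acceptance1 tau_est (th i).
have acc_density i : (\int[P (th i)]_x (acceptance tau (th i) x)%:E =
    \int[nu]_x (acceptance tau (th i) x * q (th i, x))%:E)%E.
  have [mu muE] := exists_probability (prob_kernel (s := P) (th i)).
  rewrite -(ge0_integral_density (mu := mu))//.
  - by apply: eq_measure_integral => A mA _; rewrite -muE.
  - by move=> A mA; rewrite -Pq// muE.
  - by move=> x; rewrite acceptance_ge0 acceptance_le1.
suff : (\sum_(i < n) (p i)%:E * (1 - risk tau (th i))%:E = (1 - alpha)%:E)%E.
  under eq_bigr do rewrite -EFinM mulrBr mulr1; rewrite sumEFin sumrB p1.
  by move=> -[]; lra.
under eq_bigr => i _.
  rewrite -(integral_acceptance tau_est) acc_density -ge0_integralZl_EFin//; last 2 first.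
  - by move=> x _; rewrite lee_fin mulr_ge0// acceptance_ge0.
  - by apply/measurable_EFinP; exact: measurable_funM.
  over.
rewrite -ge0_integral_sum//; last 2 first.
- by move=> i; apply/measurable_EFinP; do 2 apply: measurable_funM => //.
- by move=> i x _; rewrite lee_fin !mulr_ge0// acceptance_ge0.
rewrite (ae_eq_integral (fun x => ((1 - alpha) * m x)%:E))//.
- under eq_integral do rewrite EFinM.
  rewrite ge0_integralZl_EFin//; last 3 first.
  + by move=> x _; rewrite lee_fin.
  + exact/measurable_EFinP.
  + by rewrite subr_ge0.
  by rewrite -margE'// probability_setT mule1.
- apply: emeasurable_sum => i; apply: emeasurable_funM => //.
  by apply/measurable_EFinP; exact: measurable_funM.
- by apply/measurable_EFinP; exact: measurable_funM.
- by apply: filterS key_nu => x <- _; rewrite -sumEFin.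
Qed.

End risk.

(** * The matching prior *)

Section risk_continuity.
Variables (R : realType) (dX dT : measure_display).
Variables (X : borelMetricType dX R) (Theta : borelMetricType dT R).
Variables (P : R.-pker Theta ~> X) (tau : probability Theta R -> X -> R -> set Theta).
Hypothesis tau_est : forall pi, is_randomized_set_estimator (tau pi).
Variable th : Theta.
Hypothesis tau_cont : jointly_continuous (fun x pi => rejection (tau pi) th x).

(** At each fixed [x] continuity gives convergence of the rejection probabilities, and these are
    bounded by 1, so dominated convergence under [P th] applies. *)
Lemma cvg_risk (pi : nat -> probability Theta R) (pi0 : probability Theta R) :
  (forall e : R, 0 < e -> \forall n \near \oo, (W1 pi0 (pi n) < e%:E)%E) ->
  risk P (tau (pi n)) th @[n --> \oo] --> risk P (tau pi0) th.
Proof.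
move=> pi_cvg.
have rej_cvg x : rejection (tau (pi n)) th x @[n --> \oo] --> rejection (tau pi0) th x.
  move=> V /(@tau_cont x pi0)[[A B] [/= xA [e /= e0 eB]] ABV].
  apply: filterS (pi_cvg e e0) => n ne.
  by apply: (ABV (x, pi n)); split; [exact: nbhs_singleton|exact: eB].
have mrej pi' : measurable_fun setT (EFin \o rejection (tau pi') th).
  by apply/measurable_EFinP; exact: measurable_rejection1.
have [|||||_ _ H] := @dominated_convergence _ _ _ (P th) setT measurableT
  (fun n => EFin \o rejection (tau (pi n)) th) (EFin \o rejection (tau pi0) th) (cst 1%E).
- by move=> n; exact: mrej.
- exact: mrej.
- by apply: aeW => x _; apply: cvg_EFin; [near=> n|exact: rej_cvg].
- by apply: (integrable_01 (h := cst 1)) => [|//|x /=];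
    [exact: prob_kernel|rewrite ler01 lexx].
- apply: aeW => x n _ /=; have /andP[r0 r1] := rejection01 (tau_est (pi n)) th x.
  by rewrite lee_fin ger0_norm.
rewrite /risk; apply: fine_cvg.
by rewrite -/(risk P (tau pi0) th) -riskE.
Unshelve. all: by end_near. Qed.

Variables (f : cantor_space -> Theta) (cf : continuous f).
Hypothesis sf : set_surj [set: cantor_space] [set: Theta] f.
Hypothesis cTheta : compact [set: Theta].

Lemma continuous_risk_code_law :
  continuous (fun t : prod_topology (fun _ : seq bool => R) =>
    risk P (tau (code_law cf t)) th).
Proof.
apply: seq_continuous_prod => t t0 tt0; apply: cvg_risk.
exact: cvg_code_law.
Qed.

End risk_continuity.

Lemma continuous_threshold (R : realType) n (c : 'I_n.+1 -> cantor_space) :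
  continuous (fun p : 'rV[R]_n.+1 =>
    threshold c (fun i => p ord0 i) : prod_topology (fun _ : seq bool => R)).
Proof.
move=> p; apply: (@cvg_prod_topology _ (fun=> R)) => [|w].
  by apply: fmap_filter; exact: nbhs_filter.
apply: (@continuous_big _ _ _ _ xpredT (@add_continuous R)) => i _.
case: asboolP => _ q /=; first exact: coord_continuous.
by apply: (cvg_cst (0 : R)); exact: nbhs_filter.
Qed.

(* A pointed copy, as required by [compact_In0]. *)
Definition threshold_space (R : realType) : Type := prod_topology (fun _ : seq bool => R).
HB.instance Definition _ R := Topological.on (threshold_space R).
HB.instance Definition _ R := isPointed.Build (threshold_space R) (fun=> 0).

Theorem theorem1 (R : realType) (dX dT : measure_display)
    (X : borelMetricType dX R) (Theta : borelMetricType dT R)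
    (P : R.-pker Theta ~> X)
    (nu : {sigma_finite_measure set X -> \bar R}) (q : Theta * X -> R)
    (hq : is_density P nu q)
    (post : probability Theta R -> R.-pker X ~> Theta)
    (hpost : forall pi : probability Theta R, is_posterior P q pi (post pi))
    (alpha : R) (alpha01 : 0 < alpha < 1)
    (tau : probability Theta R -> X -> R -> set Theta)
    (htau : forall pi : probability Theta R,
        is_credible_region P pi (post pi) alpha (tau pi))
    (cTheta : compact [set: Theta])
    (hcont : forall theta : Theta,
        jointly_continuous (fun x pi => rejection (tau pi) theta x)) :
  exists pi0 : probability Theta R,
    is_credible_region P pi0 (post pi0) alpha (tau pi0) /\
    is_confidence_set P alpha (tau pi0).
Proof.
have tau_est pi : is_randomized_set_estimator (tau pi) by case: (htau pi).
have [g cf] := cantor_surj cTheta (@metric_hausdorff _ Theta).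
have sf : set_surj [set: cantor_space] [set: Theta] g by exact: surj.
set f : cantor_space -> Theta := g in cf sf.
pose G th (t : threshold_space R) :=
  risk P (tau (code_law cf t)) th.
have cG th : continuous (G th) by exact: continuous_risk_code_law.
suff [t tP] : exists t, forall th, G th t <= alpha.
  exists (code_law cf t); split; first exact: htau.
  by split => // th; rewrite riskE// lee_fin; exact: tP.
pose K := [set t : threshold_space R |
  forall w, [set` `[0 : R, 1]] (t w)].
have cK : compact K.
  apply: (@tychonoff _ (fun=> R) (fun=> [set` `[0 : R, 1]])) => w.
  exact: segment_compact.
(* By the finite intersection property in [K], it suffices to treat finitely many parameters. *)
have := cK; rewrite compact_In0.
move=> /(_ Theta setT (fun th => K `&` [set t | G th t <= alpha])); case.
- exists (fun th => [set t | G th t <= alpha]) => // th _.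
  by apply: (@preimage_closed _ _ (G th) [set x | x <= alpha]) => // t _; exact: cG.
- move=> D _.
  suff [t Kt tP] : exists2 t, K t & forall th : Theta,
      th \in finmap.enum_fset D -> G th t <= alpha.
    by exists t => th' /= /tP.
  case En : (size (finmap.enum_fset D)) => [|n].
    exists (cst 0) => [w|th]; first by rewrite /= in_itv /= lexx ler01.
    by rewrite (size0nil En).
  pose th (i : 'I_n.+1) : Theta := nth point (finmap.enum_fset D) i.
  have th_inj : injective th.
    by move=> i j /eqP; rewrite nth_uniq ?En// ?finmap.fset_uniq// => /eqP/ord_inj.
  have th_surj (y : Theta) : y \in finmap.enum_fset D -> exists i, th i = y.
    move=> yD; have yn : (index y (finmap.enum_fset D) < n.+1)%N by rewrite -En index_mem.
    by exists (Ordinal yn); rewrite /th nth_index.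
  have /choice[c fc] : forall i, exists c : cantor_space, f c = th i.
    by move=> i; have [c _ cE] := sf (th i) I; exists c.
  have c_inj : injective c by move=> i j cij; apply: th_inj; rewrite -!fc cij.
  pose v (p : 'rV[R]_n.+1) (i : 'I_n.+1) : R :=
    G (th i) (threshold c (fun j => p ord0 j)).
  have cv i : continuous (v^~ i).
    move=> p; apply: (@continuous_comp _ _ _ _ (G (th i))); last exact: cG.
    exact: continuous_threshold.
  (* The weights for which the risk is largest at [th i]; these closed sets cover the simplex. *)
  pose A i := [set p : 'rV[R]_n.+1 | forall j, v p j <= v p i].
  have [|p sp|p [p0 p1] pmax] := @KKM_dual R n A.
  - move=> i; rewrite (_ : A i = \bigcap_j [set p : 'rV[R]_n.+1 | v p j - v p i <= 0]).
      apply: closed_bigI => j _.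
      apply: (@preimage_closed _ _ (fun p : 'rV[R]_n.+1 => v p j - v p i)
        [set x | x <= 0]) => // p _.
      by apply: cvgB; first [exact: nbhs_filter | exact: cv].
    apply/seteqP; split => p H j; [move=> _; rewrite /= subr_le0; exact: H|].
    by rewrite -subr_le0; exact: H.
  - have [i _ iP] := @arg_maxP _ _ _ ord0 xpredT (v p) isT.
    by exists i => j; exact: iP.
  exists (threshold c (fun j => p ord0 j)) => [w|_ /th_surj[j <-]].
    exact: threshold_itv.
  (* The averaged risk is [alpha], and [p] charges only maximal risks, so each [v p j] is at most
     this average. *)
  have <- : \sum_i p ord0 i * v p i = alpha.
    apply: (risk_average _ hq (hpost _) (htau _) p0 p1) => [|B mB].
      by apply: ltW; case/andP: alpha01.
    rewrite code_law_finite//.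
    by apply: eq_bigr => i _; rewrite fc.
  rewrite -[leLHS]mul1r -p1 mulr_suml; apply: ler_sum => i _.
  have [pi0|pi0] := ltP 0 (p ord0 i); first by rewrite ler_pM2l//; exact: pmax.
  by have -> : p ord0 i = 0; [apply/eqP; rewrite eq_le pi0 p0|rewrite !mul0r].
- by move=> t tP; exists t => th; have [] := tP th I.
Qed.
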